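(* Let $E$ be a bounded meet semilattice. Then $E$ is compactable if and only if every tight filter in $E$ is an ultrafilter.
   Context: A bounded meet semilattice is a meet semilattice with a top element $1$ and a bottom element $0$. Elements $e,f$ are orthogonal if $e\wedge f=0$. A filter in $E$ is a nonempty subset $F\subseteq E$ such that $0\notin F$; $e,f\in F$ implies $e\wedge f\in F$; and $e\in F$, $e\le f$ implies $f\in F$. An ultrafilter is a filter that is maximal under inclusion among filters. $\mathsf{U}(E)$ denotes the set of all ultrafilters in $E$, and for $e\in E$, $\mathcal{K}_e$ denotes the set of ultrafilters containing $e$. The sets $\mathcal{K}_e$ ($e\in E$) form a base for a topology $\tau$ on $\mathsf{U}(E)$. $E$ is compactable if $(\mathsf{U}(E),\tau)$ is compact. For $X,Y\subseteq E$ (with $Y$ possibly empty), $E^{X,Y}$ is the set of all elements of $E$ that are below every element of $X$ and orthogonal to every element of $Y$. A subset $Z\subseteq E^{X,Y}$ is a cover of $E^{X,Y}$ if for each non-zero $e\in E^{X,Y}$ there exists $z\in Z$ with $e\wedge z\ne 0$. A filter $F$ in $E$ is tight if for all finite sets $X,Y\subseteq E$ with $X\subseteq F$ and $Y\cap F=\emptyset$, every finite cover $Z$ of $E^{X,Y}$ satisfies $Z\cap F\neq\emptyset$. *)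

(* Defs.v *)
From HB Require Import structures.
From mathcomp Require Import all_boot all_order.
From mathcomp Require Import all_classical topology.
Set Implicit Arguments.
Unset Strict Implicit.
Unset Printing Implicit Defensive.
Import Order.TTheory.
Local Open Scope classical_set_scope.

(* A bounded meet semilattice is a [tbMeetSemilatticeType]; the case
   \bot = \top is allowed.  The symbol `&` is overloaded: (e `&` f)%O is the
   meet of two elements, while A `&` B is the intersection of two sets. *)

Section Semilattice.
Context {d : Order.disp_t} {E : tbMeetSemilatticeType d}.
Implicit Types (e f z : E) (F G X Y Z : set E).

Definition orthogonal e f : Prop := (e `&` f)%O = \bot%O.

(* Filters of the semilattice E, to be distinguished from the library's
   [Filter], which is about filters of subsets of a type. *)
Definition meet_filter F : Prop :=
  [/\ F !=set0,
      ~ F \bot%O,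
      (forall e f, F e -> F f -> F (e `&` f)%O)
    & (forall e f, F e -> (e <= f)%O -> F f)].

Definition meet_ultrafilter F : Prop :=
  meet_filter F /\ (forall G, meet_filter G -> F `<=` G -> G = F).

Definition below_orth X Y : set E :=
  [set e | (forall x, X x -> (e <= x)%O) /\ (forall y, Y y -> orthogonal e y)].

Definition is_cover X Y Z : Prop :=
  Z `<=` below_orth X Y /\
  (forall e, below_orth X Y e -> e <> \bot%O ->
     exists2 z, Z z & (e `&` z)%O <> \bot%O).

Definition tight_filter F : Prop :=
  meet_filter F /\
  (forall X Y, finite_set X -> finite_set Y -> X `<=` F -> Y `&` F = set0 ->
     forall Z, finite_set Z -> is_cover X Y Z -> Z `&` F !=set0).

End Semilattice.

Record ultrafilters {d : Order.disp_t} (E : tbMeetSemilatticeType d) := Ultra {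
  ultra_set :> set E;
  ultra_setP : meet_ultrafilter ultra_set
}.

Section UltrafilterSpace.
Context {d : Order.disp_t} {E : tbMeetSemilatticeType d}.

Definition ultra_containing (e : E) : set (ultrafilters E) :=
  [set U | ultra_set U e].

HB.instance Definition _ := gen_eqMixin (ultrafilters E).
HB.instance Definition _ := gen_choiceMixin (ultrafilters E).

Lemma ultra_containing_cover :
  \bigcup_(B in range ultra_containing) id B = [set: ultrafilters E].
Proof.
apply/seteqP; split=> // U _.
have [[e Ue] _ _ _] := proj1 (ultra_setP U).
by exists (ultra_containing e) => //; exists e.
Qed.

Lemma ultra_containing_join (A B : set (ultrafilters E)) (U : ultrafilters E) :
  range ultra_containing A -> range ultra_containing B -> id A U -> id B U ->
  exists C, [/\ range ultra_containing C, id C U & id C `<=` id A `&` id B].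
Proof.
move=> [e _ <-] [f _ <-] Ue Uf; exists (ultra_containing (e `&` f)%O); split.
- by exists (e `&` f)%O.
- by have [_ _ UI _] := proj1 (ultra_setP U); exact: UI.
- move=> V Vef; have [_ _ _ Vup] := proj1 (ultra_setP V).
  by split; apply: Vup Vef _; [exact: leIl|exact: leIr].
Qed.

HB.instance Definition _ := isBaseTopological.Build (ultrafilters E)
  ultra_containing_cover ultra_containing_join.

End UltrafilterSpace.

(* No separation axiom is part of [compact]; the space of ultrafilters is
   always Hausdorff, so none would be lost by adding one. *)
Definition compactable {d : Order.disp_t} (E : tbMeetSemilatticeType d) : Prop :=
  compact [set: ultrafilters E].

(* Main.v *)
(* A tight filter F is an ultrafilter as soon as every a outside F is
   orthogonal to an element of F.  The sets K_f with f = a or f orthogonal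
   to a cover the whole space, so compactness gives finitely many f orthogonal
   to a that cover E^{{},{a}}, and tightness puts one of them in F.
   Conversely, an ultrafilter P of subsets of U(E) induces the filter
   {e | K_e in P} of E.  Any finite amount of information about it is realized
   by an ultrafilter of E; as ultrafilters are tight, so is the induced filter.
   If it is an ultrafilter, then P converges to it. *)
Require Import Defs.
From mathcomp Require Import all_boot all_order.
From mathcomp Require Import all_classical topology.
Set Implicit Arguments.
Unset Strict Implicit.
Unset Printing Implicit Defensive.
Import Order.TTheory.
Local Open Scope classical_set_scope.

Section MeetFilters.
Context {d : Order.disp_t} {E : tbMeetSemilatticeType d}.
Implicit Types (a e f : E) (F G : set E).

Lemma meet_filter_top F : meet_filter F -> F \top%O.
Proof. by move=> [[e Fe] _ _ Fup]; apply: Fup Fe (lex1 e). Qed.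

(** The meet of one witness for each element of [A] works for all of them at once, since [P t]
    passes to smaller elements; [\top] serves for empty [A]. *)
Lemma meet_filter_finite (T : eqType) F (A : set T) (P : T -> E -> Prop) :
  meet_filter F -> finite_set A ->
  (forall t e f, P t f -> (e <= f)%O -> P t e) ->
  (forall t, A t -> exists2 f, F f & P t f) ->
  exists2 f, F f & forall t, A t -> P t f.
Proof.
move=> mF /finite_seqP[s ->] Pdown; have [_ _ FI _] := mF.
elim: s => [_|t s IHs FP]; first by exists \top%O => //; exact: meet_filter_top.
have [u us|f Ff Pf] := IHs; first by apply: FP; rewrite /= inE us orbT.
have [g Fg Ptg] := FP t (mem_head t s).
exists (f `&` g)%O; first exact: FI.
move=> u; rewrite /= inE => /orP[/eqP->|/Pf Puf].
- exact: Pdown Ptg (leIr _ _).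
- exact: Pdown Puf (leIl _ _).
Qed.

(** If no element of [F] is orthogonal to [a], then [F] and [a] generate the filter [G] below, and
    maximality forces [a] into [F]. Conversely, a larger filter would contain both some [a] and an
    element orthogonal to it, hence [\bot]. *)
Lemma meet_ultrafilterP F : meet_filter F ->
  meet_ultrafilter F <->
  (forall a, ~ F a -> exists2 f, F f & orthogonal f a).
Proof.
move=> mF; have [_ F0 FI Fup] := mF; split=> [[_ Fmax] a nFa|Forth].
- apply: contrapT => noorth; apply: nFa.
  pose G := [set e | exists2 f, F f & (f `&` a <= e)%O].
  have FG : F `<=` G by move=> f Ff; exists f => //; exact: leIl.
  suff mG : meet_filter G.
    rewrite -(Fmax G mG FG); exists \top%O; first exact: meet_filter_top.
    exact: leIr.
  split.
  + by exists \top%O; apply: FG; exact: meet_filter_top.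
  + by move=> [f Ff]; rewrite lex0 => /eqP fa; apply: noorth; exists f.
  + move=> e1 e2 [f1 Ff1 le1] [f2 Ff2 le2].
    exists (f1 `&` f2)%O; first exact: FI.
    by rewrite lexI; apply/andP; split;
      [apply: le_trans le1|apply: le_trans le2]; rewrite leI2 // ?leIl ?leIr.
  + by move=> e1 e2 [f Ff le1] le2; exists f => //; exact: le_trans le2.
- split=> // G [_ G0 GI _] FG; apply/seteqP; split=> // a Ga.
  apply: contrapT => /Forth[f /FG Gf fa]; apply: G0.
  by rewrite -fa; exact: GI.
Qed.

Lemma meet_ultrafilter_orth F a :
  meet_ultrafilter F -> ~ F a -> exists2 f, F f & orthogonal f a.
Proof. by move=> uF; have /(meet_ultrafilterP (proj1 uF)) := uF; apply. Qed.

Lemma exists_ultra_containing e : e <> \bot%O -> ultra_containing e !=set0.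
Proof.
(* The guard [G !=set0] makes [P] hold for the union of the empty chain, which is the empty set. *)
move=> e0; pose P G := G !=set0 -> meet_filter G /\ G e.
have [|U [PU Umax]] := @Zorn_bigcup E P.
  move=> C CP Ctot [x [G0 CG0 G0x]].
  have PG G y : C G -> G y -> meet_filter G /\ G e.
    by move=> CG Gy; apply: CP CG _; exists y.
  have [_ G0e] := PG _ _ CG0 G0x.
  split; last by exists G0.
  split.
  - by exists e, G0.
  - by move=> [G CG Gb]; have [[_ + _ _] _] := PG _ _ CG Gb; exact.
  - move=> y z [G CG Gy] [H CH Hz].
    have [GH|HG] := Ctot G H CG CH.
    + have [[_ _ HI _] _] := PG _ _ CH Hz.
      by exists H => //; apply: HI => //; exact: GH.
    + have [[_ _ GI _] _] := PG _ _ CG Gy.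
      by exists G => //; apply: GI => //; exact: HG.
  - move=> y z [G CG Gy] yz; have [[_ _ _ Gup] _] := PG _ _ CG Gy.
    by exists G => //; exact: Gup yz.
have Une : U !=set0.
  apply: contrapT => /nonemptyPn U0.
  (* The principal filter of [e] would properly extend an empty [U]. *)
  apply: (Umax [set f | e <= f]%O).
    by rewrite U0; split=> // /(_ e (lexx e)).
  move=> _; split; last exact: lexx.
  split; first by exists e => /=.
  - by rewrite /= lex0 => /eqP.
  - by move=> f g /= ef eg; rewrite lexI ef.
  - by move=> f g /= ef; exact: le_trans.
have [mU Ue] := PU Une.
suff uU : meet_ultrafilter U by exists (Ultra uU).
split=> // G mG UG; apply/seteqP; split=> //.
apply: contrapT => nGU; apply: (Umax G) => //.
by move=> _; split=> //; exact: UG.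
Qed.

(** If [Z] missed [F], then [F] would contain a lower bound of [X], an element orthogonal to all of
    [Y] and one orthogonal to all of [Z]. Their meet is a nonzero element of [below_orth X Y] that
    [Z] fails to cover. *)
Lemma meet_ultrafilter_tight F : meet_ultrafilter F -> tight_filter F.
Proof.
move=> uF; have [mF _] := uF; have [_ F0 FI _] := mF.
split=> [//|] X Y finX finY XF YF0 Z finZ [_ Zcov].
apply: contrapT => /nonemptyPn ZF0.
have orthD (t e f : E) : orthogonal f t -> (e <= f)%O -> orthogonal e t.
  move=> ft ef; apply/eqP; rewrite -lex0 -ft; exact: leI2.
have orthF (A : set E) : finite_set A -> A `&` F = set0 ->
    exists2 f, F f & forall t, A t -> orthogonal f t.
  move=> finA AF; apply: (meet_filter_finite mF finA orthD) => t At.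
  apply: meet_ultrafilter_orth => // Ft.
  by have : (A `&` F) t by []; rewrite AF.
have [x Fx xX] : exists2 x, F x & forall t, X t -> (x <= t)%O.
  apply: (meet_filter_finite mF finX (P := fun t e => (e <= t)%O)).
  - by move=> t e f ft ef; exact: le_trans ft.
  - by move=> t Xt; exists t => //; exact: XF.
have [y Fy yY] := orthF Y finY YF0.
have [z Fz zZ] := orthF Z finZ ZF0.
pose e := (x `&` y `&` z)%O.
have Fe : F e := FI _ _ (FI _ _ Fx Fy) Fz.
have [| |t Zt] := Zcov e.
- split=> t; first by move=> /xX; apply: le_trans; rewrite /e -meetA leIl.
  by move=> /yY /orthD; apply; rewrite /e meetAC leIr.
- by move=> e0; apply: F0; rewrite -e0.
- by apply; apply: orthD (zZ _ Zt) _; rewrite leIr.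
Qed.

End MeetFilters.

Section UltrafilterTopology.
Context {d : Order.disp_t} {E : tbMeetSemilatticeType d}.
Implicit Types (e : E) (U : ultrafilters E) (F : set E).

Lemma open_ultra_containing e : open (@ultra_containing d E e).
Proof.
exists [set ultra_containing e]; first by move=> _ ->; exists e.
by rewrite bigcup_set1.
Qed.

Lemma nbhs_ultraP U (A : set (ultrafilters E)) :
  nbhs U A <-> exists2 e, ultra_set U e & ultra_containing e `<=` A.
Proof.
rewrite nbhsE; split=> [[B [[D sD <-] [C DC CU]] BA]|[e Ue eA]].
- have [e _ eC] := sD C DC; exists e; first by rewrite -eC in CU.
  by apply: subset_trans BA; rewrite eC; exact: bigcup_sup.
- by exists (ultra_containing e) => //; split=> //; exact: open_ultra_containing.
Qed.

Lemma compactable_tight F :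
  compactable E -> tight_filter F -> meet_ultrafilter F.
Proof.
move=> /compact_near_coveringP cE [mF Ftight].
apply/meet_ultrafilterP => // a nFa.
pose orth : set E := below_orth set0 [set a].
(* Near-covering compactness along this filter amounts to extracting a finite subcover: a property
   monotone in [W] that holds eventually holds at some finite [Z] inside [orth]. *)
pose fin : set_system (set E) :=
  filter_from [set Z | finite_set Z /\ Z `<=` orth]
    (fun Z => [set W | Z `<=` W]).
have finF : Filter fin.
  apply: filter_from_filter; first by exists set0; split.
  move=> Z1 Z2 [fin1 sub1] [fin2 sub2]; exists (Z1 `|` Z2).
    by split; [rewrite finite_setU|rewrite subUset].
  by move=> W; rewrite /= subUset.
have [|Z [finZ Zorth] Zcov] :=
    cE _ fin (fun W U => ultra_set U a \/ exists2 z, W z & ultra_set U z) finF.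
  move=> U _; have [Ua|nUa] := pselect (ultra_set U a).
    exists (ultra_containing a, setT); last by move=> [V W] [Va _]; left.
    split; last exact: filterT.
    by apply/nbhs_ultraP; exists a.
  have [z Uz za] := meet_ultrafilter_orth (ultra_setP U) nUa.
  exists (ultra_containing z, [set W | W z]).
    split; first by apply/nbhs_ultraP; exists z.
    exists [set z]; last by move=> W; exact.
    by split; [exact: finite_set1|move=> _ ->; split=> // _ ->].
  by move=> [V W] [Vz Wz]; right; exists z.
have [|||||z [Zz Fz]] := Ftight set0 [set a] _ _ _ _ Z finZ.
- exact: finite_set0.
- exact: finite_set1.
- exact: sub0set.
- by apply/seteqP; split=> // _ [-> Fa].
(* An ultrafilter containing [e] omits [a], so by the finite subcover it contains some [z] in [Z],
   and then also the meet of [e] and [z]. *)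
- split=> // e [_ /(_ a erefl) ea] e0.
  have [U Ue] := exists_ultra_containing e0.
  have [_ U0 UI _] := proj1 (ultra_setP U).
  have [Ua|[z Zz Uz]] := Zcov Z (@subset_refl _ Z) U I.
    by case: U0; rewrite -ea; exact: UI.
  exists z => // ez; apply: U0; rewrite -ez; exact: UI.
- by exists z => //; have [_] := Zorth z Zz; exact.
Qed.

Lemma induced_filter_tight (P : set_system (ultrafilters E)) :
  UltraFilter P -> tight_filter [set e | P (ultra_containing e)].
Proof.
move=> uP; have PP := ultra_proper.
have Pup e f : (e <= f)%O -> ultra_containing e `<=` @ultra_containing d E f.
  by move=> ef U Ue; have [_ _ _ Uup] := proj1 (ultra_setP U); exact: Uup ef.
split.
  split.
  - exists \top%O => /=; apply: filterS filterT => U _.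
    exact: meet_filter_top (proj1 (ultra_setP U)).
  - by move=> /filter_ex[U U0]; have [_ + _ _] := proj1 (ultra_setP U); exact.
  - move=> e f Pe Pf; apply: filterS (filterI Pe Pf) => U [Ue Uf].
    by have [_ _ UI _] := proj1 (ultra_setP U); exact: UI.
  - by move=> e f Pe ef; exact: filterS (Pup _ _ ef) Pe.
move=> X Y finX finY XP YP Z finZ Zcov; apply: contrapT => /nonemptyPn ZP.
have near_all (A : set E) (Q : E -> set (ultrafilters E)) :
    finite_set A -> (forall t, A t -> P (Q t)) ->
    P [set U | forall t, A t -> Q t U].
  by move=> /finite_fsetP[D ->]; exact: filter_bigI.
have near_avoid (A : set E) :
    finite_set A -> A `&` [set e | P (ultra_containing e)] = set0 ->
    P [set U | forall t, A t -> ~ ultra_set U t].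
  move=> finA AP; apply: near_all => // t At.
  (* Maximality of [P] enters here: it contains the complement of each [ultra_containing t] that it
     omits. *)
  have [Pt|//] := in_ultra_setVsetC (ultra_containing t) uP.
  by have : (A `&` [set e | P (ultra_containing e)]) t by []; rewrite AP.
have [U [UX [UY UZ]]] := filter_ex
  (filterI (near_all X ultra_containing finX XP)
    (filterI (near_avoid Y finY YP) (near_avoid Z finZ ZP))).
(* The point [U] contains [X] and misses both [Y] and [Z], against its own tightness. *)
have [_ Utight] := meet_ultrafilter_tight (ultra_setP U).
have [|z [/UZ]//] := Utight X Y finX finY UX _ Z finZ Zcov.
by apply/seteqP; split=> // y [/UY].
Qed.

Lemma tight_compactable :
  (forall F, tight_filter F -> meet_ultrafilter F) -> compactable E.
Proof.
move=> tightU; rewrite /compactable compact_ultra => P uP _.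
exists (Ultra (tightU _ (induced_filter_tight uP))); split=> // A.
(* Membership of [e] in the limit point means by definition that [P] contains the basic
   neighbourhood [ultra_containing e]. *)
move=> /nbhs_ultraP[e Pe eA].
exact: filterS eA Pe.
Qed.

End UltrafilterTopology.

Theorem theorem2p5 (d : Order.disp_t) (E : tbMeetSemilatticeType d) :
  compactable E <->
  (forall F : set E, tight_filter F -> meet_ultrafilter F).
Proof.
split=> [cE F|]; [exact: compactable_tight|exact: tight_compactable].
Qed.
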